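(* Let $X$ be a $C^*$-embedded subspace of an extremally disconnected space. If $X$ is $\mathrm{I}$-favorable with respect to co-zero sets, then $X$ is extremally disconnected.
   Context: All spaces are Tychonoff. A space is extremally disconnected if the closure of every open set is open. A subspace $X\subset Y$ is $C^*$-embedded in $Y$ if every bounded continuous real-valued function on $X$ extends to a continuous real-valued function on $Y$. **I-favorable with respect to co-zero sets.** Let $\Sigma_X$ be the family of all non-empty co-zero sets in a space $X$. Two players play as follows: at round $n\ge 0$ Player I chooses $A_n\in\Sigma_X$ and Player II replies with $B_n\in\Sigma_X$, $B_n\subset A_n$. Player I wins if $\bigcup_{n\ge 0}B_n$ is dense in $X$; otherwise Player II wins. $X$ is $\mathrm{I}$-favorable with respect to co-zero sets if Player I has a winning strategy, i.e. a function $\sigma:\bigcup\{\Sigma_X^n:n\ge 0\}\to\Sigma_X$ such that for every play in which Player I plays $A_0=\sigma(\varnothing)$ (value at the empty sequence) and $A_{k+1}=\sigma(B_0,\dots,B_k)$ for all $k\ge 0$, and Player II plays $B_k\in\Sigma_X$ with $B_k\subset A_k$ for all $k\geq 0$, the union $\bigcup_{n\ge 0}B_n$ is dense in $X$. *)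

(* Defs.v *)
From HB Require Import structures.
From mathcomp Require Import all_boot all_order all_algebra.
From mathcomp Require Import all_classical all_reals all_analysis.
Import Order.TTheory GRing.Theory Num.Theory.
Import numFieldNormedType.Exports.

Set Implicit Arguments.
Unset Strict Implicit.
Unset Printing Implicit Defensive.

Local Open Scope classical_set_scope.
Local Open Scope ring_scope.

(* [completely_regular_space] separates points from closed sets by a uniformity;
   [uniform_separatorP] gives the version with continuous functions to [0, 1]. *)
Definition tychonoff_space (T : topologicalType) : Prop :=
  completely_regular_space T /\ hausdorff_space T.

Definition extremally_disconnected (T : topologicalType) : Prop :=
  forall U : set T, open U -> open (closure U).

Definition C_star_embedded (R : realType) (Y : topologicalType) (X : set Y)
    : Prop :=
  forall f : set_type X -> R, continuous f -> bounded_fun f ->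
    exists g : Y -> R, continuous g /\ forall x : set_type X, g (set_val x) = f x.

Definition cozero_set (R : realType) (T : topologicalType) (U : set T) : Prop :=
  exists f : T -> R, continuous f /\ U = [set x | f x != 0].

Definition Sigma (R : realType) (T : topologicalType) : Type :=
  {U : set T | cozero_set R U /\ U !=set0}.

(* [mkseq B k] is the sequence B_0, ..., B_(k-1) of the first k moves of
   Player II, so [sigma (mkseq B k)] is the move A_k of Player I. *)
Definition winning_strategy (R : realType) (T : topologicalType)
    (sigma : seq (Sigma R T) -> Sigma R T) : Prop :=
  forall B : nat -> Sigma R T,
    (forall k : nat, sval (B k) `<=` sval (sigma (mkseq B k))) ->
    dense (\bigcup_n sval (B n)).

Definition I_favorable_cozero (R : realType) (T : topologicalType) : Prop :=
  exists sigma : seq (Sigma R T) -> Sigma R T, winning_strategy sigma.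

(* Main.v *)
Require Import Defs.
From mathcomp Require Import all_boot all_order all_algebra.
From mathcomp Require Import all_classical all_reals all_analysis.
From mathcomp Require Import lra.
Import Order.TTheory GRing.Theory Num.Theory.
Import numFieldNormedType.Exports.

(** Let [U] be open in [X] and let [V] be the complement of its closure; it is
    enough to show that the closures of [U] and [V] are disjoint.

    Favorability is used once, as a chain condition.  Since the union of [U]
    and [V] is dense, Player II can answer every move of Player I by a co-zero
    set contained in [U] or in [V].  Against a winning strategy the answers have
    a dense union, so those lying in [U] form a dense subset of [U] and those
    lying in [V] form a dense subset of [V] ([I_favorable_dense_cozero]).  There
    are only countably many answers, and a countable union of co-zero sets is
    co-zero ([cozero_bigcup]).  Thus [U] and [V] have dense co-zero subsets [U']
    and [V'].

    The difference of bounded functions cutting out [U'] and [V'] is positive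
    on [U'] and negative on [V'].  Its extension [h] to the ambient space [Y]
    yields disjoint open sets, where [h] is positive and where it is negative;
    their closures are disjoint because [Y] is extremally disconnected, and
    they contain the closures of [U'] and [V'], which are those of [U] and [V]
    ([cozero_disjoint_closure]). *)

Set Implicit Arguments.
Unset Strict Implicit.

Local Open Scope classical_set_scope.
Local Open Scope ring_scope.

(** * Extremal disconnectedness as separation of disjoint open sets *)

(** The two closures can be peeled off one at a time: a neighborhood of a
    common point is [closure U] itself, open by hypothesis, so [V] meets
    [closure U], and then, [V] being open, it meets [U]. *)
Lemma extremally_disconnected_closure0 (T : topologicalType) (U V : set T) :
  extremally_disconnected T -> open U -> open V -> U `&` V = set0 ->
  closure U `&` closure V = set0.
Proof.
move=> edT oU oV UV0; rewrite -subset0 => x [clUx clVx].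
have [y [Vy clUy]] := clVx _ (open_nbhs_nbhs (conj (edT U oU) clUx)).
have [z [Uz Vz]] := clUy _ (open_nbhs_nbhs (conj oV Vy)).
by have : (U `&` V) z by []; rewrite UV0.
Qed.

Lemma open_closureC (T : topologicalType) (U : set T) : open (~` closure U).
Proof. by apply: closed_openC; exact: closed_closure. Qed.

Lemma setI_closureC (T : topologicalType) (U : set T) :
  U `&` ~` closure U = set0.
Proof. by apply/disjoints_subset; rewrite setCK; exact: subset_closure. Qed.

(** Together the two closures always cover the space, so when they are disjoint
    each is the complement of the other, hence open. *)
Lemma closure_closureC_extremally_disconnected (T : topologicalType) :
  (forall U : set T, open U -> closure U `&` closure (~` closure U) = set0) ->
  extremally_disconnected T.
Proof.
move=> sepT U oU; suff -> : closure U = ~` closure (~` closure U).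
  exact: open_closureC.
rewrite eqEsubset; split=> [x clUx clVx|x nx].
  by have : (closure U `&` closure (~` closure U)) x by []; rewrite sepT.
by apply: contrapT => nclUx; apply/nx/subset_closure.
Qed.

Lemma dense_setU_closureC (T : topologicalType) (U : set T) :
  dense (U `|` ~` closure U).
Proof.
move=> G [x Gx] oG; have [clUx|nUx] := pselect (closure U x).
  have [y [Uy Gy]] := clUx _ (open_nbhs_nbhs (conj oG Gx)).
  by exists y; split=> //; left.
by exists x; split=> //; right.
Qed.

Lemma closure_subset_closure (T : topologicalType) (A B : set T) :
  A `<=` closure B -> closure A `<=` closure B.
Proof.
move=> /closure_subset AB x /AB.
by rewrite -(proj1 (closure_id (closure B)))//; exact: closed_closure.
Qed.

Lemma closure_preimage (T Z : topologicalType) (h : T -> Z) (A : set Z) :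
  continuous h -> closure (h @^-1` A) `<=` h @^-1` closure A.
Proof.
move=> ch x clx B nB; have [y [Ay By]] := clx _ (ch x _ nB).
by exists (h y).
Qed.

Lemma set_val_continuous (T : topologicalType) (X : set T) :
  continuous (set_val : set_type X -> T).
Proof. exact: initial_continuous. Qed.

(** * Co-zero sets *)

Lemma cozero_setP (R : realType) (T : topologicalType) (U : set T) :
  cozero_set R U <->
  exists f : T -> R, [/\ continuous f, forall x, 0 <= f x <= 1 &
    U = [set x | 0 < f x]].
Proof.
split=> [[f [cf ->]]|[f [cf f01 ->]]]; last first.
  exists f; split=> //; apply/seteqP; split=> x /=; rewrite lt0r.
    by case/andP.
  by move=> ->; case/andP: (f01 x).
exists (fun x => Num.min `|f x| 1); split=> [x|x|].
- apply: (@continuous_min _ _ (fun x => `|f x|) (cst 1)); last exact: cvg_cst.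
  by apply: continuous_comp; [exact: cf|exact: norm_continuous].
- by rewrite le_min normr_ge0 ler01/= ge_min lexx orbT.
- by apply/seteqP; split=> x /=; rewrite lt_min normr_gt0 ltr01 andbT.
Qed.

(** If [U n] is the set where [u n] is positive and [0 <= u n <= 1 / n.+1], the
    union is the set where [g = sup_n u n] is positive.  The supremum is
    continuous because up to any error [e] only the finitely many [u n] with
    [1 / n.+1 > e] matter, and these vary little near a given point.  Indices
    outside [D] get [u n = 0]. *)
Lemma cozero_bigcup (R : realType) (T : topologicalType) (D : set nat)
    (U : nat -> set T) :
  (forall n, D n -> cozero_set R (U n)) -> cozero_set R (\bigcup_(n in D) U n).
Proof.
move=> cozU.
have /choice[u uP] (n : nat) : exists u : T -> R, [/\ continuous u,
    forall x, 0 <= u x <= n.+1%:R^-1 &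
    forall x, 0 < u x <-> D n /\ U n x].
  have [Dn|nDn] := pselect (D n); last first.
    exists (fun=> 0); split=> [x|x|x]; first exact: cvg_cst.
      by rewrite lexx invr_ge0 ler0n.
    by rewrite ltxx; split=> // -[].
  have /cozero_setP[f [cf f01 UE]] := cozU n Dn.
  exists (fun x => n.+1%:R^-1 * f x); split=> [x|x|x].
  - by apply: cvgM; [exact: cvg_cst|exact: cf].
  - have /andP[f0 f1] := f01 x.
    by rewrite mulr_ge0 ?invr_ge0 ?ler0n//= ler_piMr ?invr_ge0 ?ler0n.
  - rewrite pmulr_rgt0 ?invr_gt0 ?ltr0n// UE; split=> [|[]]//.
pose g x := sup (range (u ^~ x)).
have ub x : has_ubound (range (u ^~ x)).
  exists 1 => _ [n _ <-]; have [_ u1 _] := uP n; have /andP[_ ] := u1 x.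
  by move=> /le_trans; apply; rewrite invf_le1 ?ler1n ?ltr0n.
have le_g n x : u n x <= g x by apply: ub_le_sup; [exact: ub|exists n].
have g_le x c : (forall n, u n x <= c) -> g x <= c.
  move=> h; apply: ge_sup; first by exists (u 0%N x), 0%N.
  by move=> _ [n _ <-].
have g_ge0 x : 0 <= g x.
  by apply: le_trans (le_g 0%N x); have [_ h _] := uP 0%N; case/andP: (h x).
exists g; split; last first.
  apply/seteqP; split=> x /=.
    move=> [n Dn Unx]; rewrite gt_eqF//; apply: lt_le_trans (le_g n x).
    by have [_ _ h] := uP n; apply/h.
  move=> /eqP gx0; apply: contrapT => nU; apply: gx0; apply/eqP.
  rewrite eq_le g_ge0 andbT; apply: g_le => n; rewrite leNgt; apply/negP.
  by have [_ _ h] := uP n => /h[Dn Unx]; apply: nU; exists n.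
move=> x; apply/cvgrPdist_le => e e0.
have [N Ne] : exists N, forall n, (N <= n)%N -> n.+1%:R^-1 <= e.
  have [N _ hN] := near_infty_natSinv_lt (PosNum e0).
  by exists N => n Nn; apply/ltW/hN.
(* A single neighborhood has to serve all [n < N] at once, hence the
   induction on [N]. *)
have close : \forall y \near x, forall n, (n < N)%N -> `|u n x - u n y| <= e.
  elim: N {Ne} => [|N IH]; first exact: nearW.
  have [cu _ _] := uP N; have /cvgrPdist_le/(_ e e0) := cu x.
  move: IH; apply: filterS2 => y IH uN n; rewrite ltnS leq_eqVlt.
  by case/orP => [/eqP->//|/IH].
near=> y.
have close_y : forall n, (n < N)%N -> `|u n x - u n y| <= e by near: y.
have {close_y} close_y n : `|u n x - u n y| <= e.
  have [/close_y//|Nn] := ltnP n N.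
  have [_ b _] := uP n; have := b x; have := b y; have := Ne n Nn.
  move: (u n x) (u n y) (n.+1%:R^-1) => a c d de /andP[c0 cd] /andP[a0 ad].
  by rewrite ler_distl; lra.
rewrite ler_distl; apply/andP; split.
  rewrite lerBlDr; apply: g_le => n.
  rewrite (le_trans _ (lerD (le_g n x) (lexx e)))//.
  by have := close_y n; rewrite ler_distl => /andP[]; rewrite lerBlDr.
apply: g_le => n; rewrite (le_trans _ (lerD (le_g n y) (lexx e)))//.
by have := close_y n; rewrite ler_distl => /andP[].
Unshelve. all: by end_near. Qed.

Lemma disjoint_cozero_sign (R : realType) (T : topologicalType)
    (U V : set T) :
  cozero_set R U -> cozero_set R V -> U `&` V = set0 ->
  exists h : T -> R, [/\ continuous h, forall x, `|h x| <= 1,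
    U `<=` [set x | 0 < h x] & V `<=` [set x | h x < 0]].
Proof.
move=> /cozero_setP[f [cf f01 UE]] /cozero_setP[g [cg g01 VE]] UV0.
have UV x : U x -> V x -> False.
  by move=> Ux Vx; have : (U `&` V) x by []; rewrite UV0.
exists (fun x => f x - g x); split=> [x|x|x Ux|x Vx].
- by apply: cvgB; [exact: cf|exact: cg].
- have /andP[f0 f1] := f01 x; have /andP[g0 g1] := g01 x.
  by rewrite ler_norml; lra.
- have : ~ V x by exact: UV.
  move: Ux; rewrite UE VE /= => fx /negP; rewrite -leNgt => gx.
  by have /andP[] := g01 x; lra.
- have : ~ U x by move/UV; exact.
  move: Vx; rewrite UE VE /= => gx /negP; rewrite -leNgt => fx.
  by have /andP[] := f01 x; lra.
Qed.

(** * Extending a separating function *)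

(** Disjoint open subsets of [X] need not be traces of disjoint open subsets of
    [Y]; co-zero ones lie inside such traces, because one function on [X]
    separates them by its sign and the signs persist under extension. *)
Lemma cozero_disjoint_closure (R : realType) (Y : topologicalType) (X : set Y)
    (U V : set (set_type X)) :
  extremally_disconnected Y -> C_star_embedded R X ->
  cozero_set R U -> cozero_set R V -> U `&` V = set0 ->
  closure U `&` closure V = set0.
Proof.
move=> edY embX cU cV UV0.
have [f [cf f1 Uf Vf]] := disjoint_cozero_sign cU cV UV0.
have [|h [ch hE]] := embX f cf.
  exists 1; split=> [|M M1 x _]; first exact: num_real.
  exact: le_trans (f1 x) (ltW M1).
pose P := [set y | 0 < h y]; pose Q := [set y | h y < 0].
have oP : open P by apply: open_comp (@open_gt R 0) => y _; exact: ch.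
have oQ : open Q by apply: open_comp (@open_lt R 0) => y _; exact: ch.
have PQ0 : P `&` Q = set0.
  by rewrite -subset0 => y [/= /lt_trans h0 /h0]; rewrite ltxx.
have UP : U `<=` set_val @^-1` P by move=> x /Uf; rewrite /P /= hE.
have VQ : V `<=` set_val @^-1` Q by move=> x /Vf; rewrite /Q /= hE.
rewrite -subset0 => x [clU clV].
have : (closure P `&` closure Q) (set_val x).
  split.
    by apply/closure_preimage/(closure_subset UP clU)/set_val_continuous.
  by apply/closure_preimage/(closure_subset VQ clV)/set_val_continuous.
by rewrite extremally_disconnected_closure0.
Qed.

(** * Complete regularity *)

Lemma completely_regular_set_type (R : realType) (Y : topologicalType)
    (X : set Y) :
  completely_regular_space Y -> completely_regular_space (set_type X).
Proof.
move=> crY a B clB nBa; apply/(@uniform_separatorP _ R).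
have [W oW WE] : open (~` B) by exact: closed_openC.
have Wa : W (set_val a) by have : (~` B) a by []; rewrite -WE.
have /(@uniform_separatorP _ R)[f [cf f01 f0 f1]] :
  uniform_separator [set set_val a] (~` W).
  by apply: crY; [exact: open_closedC|exact].
exists (f \o set_val); split.
- move=> x; apply: continuous_comp; [exact: set_val_continuous|exact: cf].
- by move=> _ [x _ <-]; apply: f01; exists (set_val x).
- by move=> _ [_ -> <-]; apply: f0; exists (set_val a).
- move=> _ [x Bx <-]; apply: f1; exists (set_val x) => //= Wx.
  by have : (~` B) x by rewrite -WE.
Qed.

Lemma cozero_nbhs (R : realType) (T : topologicalType) (W : set T) (x : T) :
  completely_regular_space T -> open W -> W x ->
  exists A : set T, [/\ cozero_set R A, A x & A `<=` W].
Proof.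
move=> crT oW Wx.
have /(@uniform_separatorP _ R)[f [cf _ f0 f1]] :
  uniform_separator [set x] (~` W).
  by apply: crT; [exact: open_closedC|exact].
exists [set y | 1 - f y != 0]; split.
- exists (fun y => 1 - f y); split=> // y.
  by apply: cvgB; [exact: cvg_cst|exact: cf].
- by rewrite /= (imsub1 f0)//= subr0 oner_neq0.
- move=> y /= /eqP fy; apply: contrapT => nWy; apply: fy.
  by rewrite (imsub1 f1)// subrr.
Qed.

(** * Playing against a winning strategy *)

(** If Player II can always answer within the class [P], then letting Player II
    do so against a winning strategy gives a play with the desired moves.  The
    history of the play is built first, and the moves are read off from it. *)
Lemma I_favorable_dense_replies (R : realType) (T : topologicalType)
    (P : set T -> Prop) :
  I_favorable_cozero R T ->
  (forall A : Sigma R T, exists B : Sigma R T,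
    sval B `<=` sval A /\ P (sval B)) ->
  exists B : nat -> Sigma R T,
    (forall n, P (sval (B n))) /\ dense (\bigcup_n sval (B n)).
Proof.
move=> [sigma win] /choice[reply replyP].
pose hist n := iter n (fun s => rcons s (reply (sigma s))) [::].
pose B n := reply (sigma (hist n)).
have histE n : mkseq B n = hist n.
  by elim: n => // n IH; rewrite mkseqS IH.
exists B; split=> [n|]; first by have [] := replyP (sigma (hist n)).
by apply: win => n; rewrite histE; have [] := replyP (sigma (hist n)).
Qed.

(** [U'] and [V'] collect the answers of Player II that lie in [U] and in [V].
    An answer lying in [V] misses [U], so a nonempty open subset of [U] can only
    be met by answers lying in [U]. *)
Lemma I_favorable_dense_cozero (R : realType) (T : topologicalType)
    (U V : set T) :
  completely_regular_space T -> I_favorable_cozero R T ->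
  open U -> open V -> U `&` V = set0 -> dense (U `|` V) ->
  exists U' V' : set T, [/\ cozero_set R U', cozero_set R V',
    U' `<=` U /\ V' `<=` V & U `<=` closure U' /\ V `<=` closure V'].
Proof.
move=> crT favT oU oV UV0 dUV.
pose P (B : set T) := B `<=` U \/ B `<=` V.
have [A|B [BUV dB]] := I_favorable_dense_replies (P := P) favT.
  have [cA A0] := proj2_sig A.
  have oA : open (sval A).
    have [f [cf ->]] := cA.
    by apply: open_comp (@open_neq R 0) => y _; exact: cf.
  have [x [Ax UVx]] := dUV _ A0 oA.
  have reply W : open W -> W x -> exists B : Sigma R T,
      sval B `<=` sval A /\ sval B `<=` W.
    move=> oW Wx.
    have [C [cC Cx CAW]] := cozero_nbhs R crT (openI oA oW) (conj Ax Wx).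
    by exists (exist _ C (conj cC (ex_intro _ x Cx))); split=> y /CAW[].
  case: UVx => [/(reply _ oU)|/(reply _ oV)] [C [CA CW]]; exists C; split=> //.
    by left.
  by right.
pose part W := \bigcup_(n in [set n | sval (B n) `<=` W]) sval (B n).
have part_dense W W' : open W -> W `&` W' = set0 ->
    (forall n, sval (B n) `<=` W \/ sval (B n) `<=` W') ->
    W `<=` closure (part W).
  move=> oW WW0 BWW x Wx N; rewrite nbhsE => -[G [oG Gx] GN].
  have [|y [[Gy Wy] [n _ Bny]]] := dB (G `&` W) _ (openI oG oW).
    by exists x.
  exists y; split; last exact: GN.
  exists n => //=; have [//|/(_ _ Bny) W'y] := BWW n.
  by have : (W `&` W') y by []; rewrite WW0.
exists (part U), (part V); split.
- by apply: cozero_bigcup => n _; case: (proj2_sig (B n)).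
- by apply: cozero_bigcup => n _; case: (proj2_sig (B n)).
- by split=> x [n BW /BW].
- split; first exact: part_dense BUV.
  apply: (part_dense V U) => // [|n]; first by rewrite setIC.
  by case: (BUV n); [right|left].
Qed.

Theorem corollary1p3 (R : realType) (Y : topologicalType) (X : set Y)
    (tychonoffY : tychonoff_space Y)
    (edY : extremally_disconnected Y)
    (embX : C_star_embedded R X)
    (favX : I_favorable_cozero R (set_type X)) :
  extremally_disconnected (set_type X).
Proof.
have crX : completely_regular_space (set_type X).
  by apply: (completely_regular_set_type R); case: tychonoffY.
apply: closure_closureC_extremally_disconnected => U oU.
have oV := open_closureC U; have UV0 := setI_closureC U.
have [U' [V' [cU' cV' [U'U V'V] [UU' VV']]]] :=
  I_favorable_dense_cozero crX favX oU oV UV0 (dense_setU_closureC U).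
have : closure U' `&` closure V' = set0.
  apply: cozero_disjoint_closure edY embX cU' cV' _.
  exact: subsetI_eq0 UV0.
by apply: subsetI_eq0; exact: closure_subset_closure.
Qed.
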